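(* Let $c\in\{-1,0,1\}$, let $I$ be an open interval, let $w:I\to(0,\infty)$ be smooth, fix $t_0\in I$, and set $\theta(t):=\int_{t_0}^t\frac{ds}{w(s)}$. A regular, spacelike curve $\overline\gamma$ of $\mathbb Q^2_c\times_w I$ with null acceleration takes the form $$\overline\gamma=\big(\cos_c(\theta\circ\tau)\,\gamma+\sin_c(\theta\circ\tau)\,\nu,\ \tau\big),$$ where $\gamma$ is a regular curve of $\mathbb Q^2_c$ with unit normal vector $\nu$, $\tau\in C^2(\mathbb R)$, and the curvature $\kappa$ of $\gamma$ with respect to $\nu$ satisfies $$\kappa=\left(\frac{w'\,\mathrm{cot}_c(\theta)-c}{w'+\mathrm{cot}_c(\theta)}\right)\circ\tau.$$
   Context: $\mathbb Q^{2}_c$ is the $2$-dimensional simply connected space form of curvature $c$: $\mathbb Q^{2}_0=\mathbb R^{2}$ with the Euclidean metric; $\mathbb Q^{2}_1=\mathbb S^{2}\subset\mathbb R^{3}$ is the unit sphere; $\mathbb Q^{2}_{-1}=\mathbb H^{2}=\{x\in\mathbb R^{3}_1 : \langle x,x\rangle_1=-1,\ x_{3}>0\}$, where $\langle\cdot,\cdot\rangle_1=dx_1^2+dx_2^2-dx_3^2$. The metric of $\mathbb Q^2_c$ and of its ambient space are both denoted $\langle\cdot,\cdot\rangle$. $(\cos_c(t),\sin_c(t))$ equals $(\cos t,\sin t)$ if $c=1$, $(1,t)$ if $c=0$, $(\cosh t,\sinh t)$ if $c=-1$, and $\mathrm{cot}_c=\cos_c/\sin_c$. $\mathbb Q^{2}_c\times_w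 I$ is the product $\mathbb Q^{2}_c\times I$ with the Lorentzian warped metric $\langle\cdot,\cdot\rangle_w:=w(t)^2\langle\cdot,\cdot\rangle-dt^2$. A regular curve is spacelike if $\langle\overline\gamma',\overline\gamma'\rangle_w>0$. Its acceleration is its mean curvature (curvature) vector, i.e. the covariant derivative of its unit tangent vector along itself (arc-length parametrization); it is null if its $\langle\cdot,\cdot\rangle_w$-square vanishes identically. The function $\tau$ is $I$-valued, and $w'=dw/dt$. The unit normal $\nu$ of $\gamma$ is tangent to $\mathbb Q^2_c$, and the curvature $\kappa$ of $\gamma$ with respect to $\nu$ is given by $\nu'=-\kappa\,\gamma'$.
   Formalization: The acceleration is assumed collinear to one continuous null normal field (it may not switch null directions at zeros); regularity of γ and the formula for κ are claimed only where w'+cot_c(θ)≠0, with κ=w' where sin_c(θ)=0. *)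

(* Defs.v *)
From Stdlib Require Export Reals ZArith.
From Coquelicot Require Export Coquelicot.
Open Scope R_scope.

Definition open_interval (a b : Rbar) (t : R) : Prop := Rbar_lt a t /\ Rbar_lt t b.

(* [Derive] is total, so all lower orders of differentiability are required too. *)
Definition C_on (D : R -> Prop) (n : nat) (f : R -> R) : Prop :=
  forall t, D t ->
    (forall k, (k <= n)%nat -> ex_derive_n f k t) /\ continuous (Derive_n f n) t.

Definition smooth_on (D : R -> Prop) (f : R -> R) : Prop := forall n, C_on D n f.

(** * The space forms *)

Inductive axis : Set := X1 | X2 | X3.

Definition vec : Type := axis -> R.

(* Signature of the ambient metric: (+,+,-) for c = -1, (+,+,+) otherwise. *)
Definition sgn (c : Z) (i : axis) : R :=
  match c, i with Zneg _, X3 => -1 | _, _ => 1 end.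

Definition inner (c : Z) (x y : vec) : R :=
  sgn c X1 * x X1 * y X1 + sgn c X2 * x X2 * y X2 + sgn c X3 * x X3 * y X3.

(* The flat plane R^2 is identified with the plane x3 = 0 of R^3, so that the
   three space forms share one type of ambient vectors. *)
Definition in_Q (c : Z) (x : vec) : Prop :=
  match c with
  | Z0 => x X3 = 0
  | Zpos _ => inner c x x = 1
  | Zneg _ => inner c x x = -1 /\ 0 < x X3
  end.

Definition tangent_Q (c : Z) (x v : vec) : Prop :=
  match c with
  | Z0 => v X3 = 0
  | _ => inner c x v = 0
  end.

(* Orthogonal projection on the tangent plane at x: for c = 1, -1 the normal
   line is spanned by x and <x, x> = c; for c = 0 the vectors to be projected
   already lie in the plane x3 = 0. *)
Definition proj_Q (c : Z) (x v : vec) : vec :=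
  fun i => v i - IZR c * inner c x v * x i.

Definition cos_c (c : Z) (t : R) : R :=
  match c with Z0 => 1 | Zpos _ => cos t | Zneg _ => cosh t end.

Definition sin_c (c : Z) (t : R) : R :=
  match c with Z0 => t | Zpos _ => sin t | Zneg _ => sinh t end.

Definition cot_c (c : Z) (t : R) : R := cos_c c t / sin_c c t.

(** * The warped product *)

(* [Some i] are the coordinates of R^3, [None] is the coordinate t of I. *)
Definition coord : Set := option axis.

Definition pt : Type := coord -> R.

Definition space (p : pt) : vec := fun i => p (Some i).

Definition coord_eq_dec (k l : coord) : {k = l} + {k <> l}.
Proof. decide equality; decide equality. Defined.

Definition sum_coord (f : coord -> R) : R :=
  f (Some X1) + f (Some X2) + f (Some X3) + f None.

(* Components g_kl of the metric w(t)^2 <,> - dt^2 on R^3 x I. *)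
Definition metric (c : Z) (w : R -> R) (p : pt) (k l : coord) : R :=
  if coord_eq_dec k l then
    match k with
    | Some i => w (p None) ^ 2 * sgn c i
    | None => -1
    end
  else 0.

Definition dotw (c : Z) (w : R -> R) (p X Y : pt) : R :=
  sum_coord (fun k => sum_coord (fun l => metric c w p k l * X k * Y l)).

Definition partial (k : coord) (f : pt -> R) (p : pt) : R :=
  Derive (fun h => f (fun l => if coord_eq_dec l k then p l + h else p l)) 0.

(* Christoffel symbol Gamma^k_ij; since g is diagonal, g^{kl} reduces to 1 / g_kk. *)
Definition christoffel (c : Z) (w : R -> R) (p : pt) (k i j : coord) : R :=
  / (2 * metric c w p k k) *
  (partial i (fun q => metric c w q j k) p
   + partial j (fun q => metric c w q i k) p
   - partial k (fun q => metric c w q i j) p).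

Definition velocity (X : R -> pt) (s : R) : pt := fun k => Derive (fun r => X r k) s.

Definition cov_ambient (c : Z) (w : R -> R) (g X : R -> pt) (s : R) : pt :=
  fun k => velocity X s k
    + sum_coord (fun i => sum_coord (fun j =>
        christoffel c w (g s) k i j * velocity g s i * X s j)).

(* Covariant derivative, in Q_c x_w I, of the vector field X along the curve g:
   tangential part of the ambient one, the normal space being that of Q_c. *)
Definition cov (c : Z) (w : R -> R) (g X : R -> pt) (s : R) : pt :=
  fun k => match k with
           | Some i => proj_Q c (space (g s)) (space (cov_ambient c w g X s)) i
           | None => cov_ambient c w g X s None
           end.

Definition speed (c : Z) (w : R -> R) (g : R -> pt) (s : R) : R :=
  sqrt (dotw c w (g s) (velocity g s) (velocity g s)).

Definition unit_tangent (c : Z) (w : R -> R) (g : R -> pt) (s : R) : pt :=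
  fun k => velocity g s k / speed c w g s.

(* The factor 1 / speed turns the derivative in s into the arc-length derivative. *)
Definition acceleration (c : Z) (w : R -> R) (g : R -> pt) (s : R) : pt :=
  fun k => cov c w g (unit_tangent c w g) s k / speed c w g s.

Definition curve_in (c : Z) (I J : R -> Prop) (g : R -> pt) : Prop :=
  (forall k, C_on J 2 (fun s => g s k)) /\
  (forall s, J s -> in_Q c (space (g s)) /\ I (g s None)).

Definition regular_curve (J : R -> Prop) (g : R -> pt) : Prop :=
  forall s, J s -> exists k, velocity g s k <> 0.

Definition spacelike (c : Z) (w : R -> R) (J : R -> Prop) (g : R -> pt) : Prop :=
  forall s, J s -> 0 < dotw c w (g s) (velocity g s) (velocity g s).

Definition null_acceleration (c : Z) (w : R -> R) (J : R -> Prop) (g : R -> pt) : Prop :=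
  forall s, J s ->
    dotw c w (g s) (acceleration c w g s) (acceleration c w g s) = 0.

(* A spacelike curve has two null normal directions, and a null acceleration may
   pass from one to the other where it vanishes, as for
   s |-> ((s, s^4), s^3 |s|) with c = 0, w = 1.  This is the condition that it
   does not: it is collinear to one continuous null normal field.  It holds
   in particular when the acceleration vanishes nowhere, or everywhere. *)
Definition fixed_null_direction (c : Z) (w : R -> R) (J : R -> Prop) (g : R -> pt) : Prop :=
  exists N : R -> pt, forall s, J s ->
    (forall k, continuous (fun r => N r k) s) /\
    (exists k, N s k <> 0) /\
    tangent_Q c (space (g s)) (space (N s)) /\
    dotw c w (g s) (N s) (N s) = 0 /\
    dotw c w (g s) (N s) (velocity g s) = 0 /\
    (exists f : R, forall k, acceleration c w g s k = f * N s k).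

(** * Curves of the space form *)

Definition vvelocity (x : R -> vec) (s : R) : vec := fun i => Derive (fun r => x r i) s.

Definition unit_normal (c : Z) (J : R -> Prop) (gam nu : R -> vec) : Prop :=
  (forall i, C_on J 1 (fun s => nu s i)) /\
  (forall s, J s ->
    tangent_Q c (gam s) (nu s) /\ inner c (nu s) (nu s) = 1 /\
    inner c (nu s) (vvelocity gam s) = 0).

Definition theta (w : R -> R) (t0 t : R) : R := RInt (fun s => / w s) t0 t.

(* (w' cot_c(theta) - c) / (w' + cot_c(theta)); where sin_c(theta) = 0, i.e.
   cot_c(theta) = oo, the value is the limit w'. *)
Definition kappa_formula (c : Z) (w : R -> R) (t0 t : R) : R :=
  if Req_EM_T (sin_c c (theta w t0 t)) 0 then Derive w t
  else (Derive w t * cot_c c (theta w t0 t) - IZR c)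
       / (Derive w t + cot_c c (theta w t0 t)).

Definition kappa_defined (c : Z) (w : R -> R) (t0 t : R) : Prop :=
  sin_c c (theta w t0 t) <> 0 -> Derive w t + cot_c c (theta w t0 t) <> 0.

(* Main.v *)
Require Import Defs.
From Stdlib Require Import Lra Lia Nsatz FunctionalExtensionality Classical_Pred_Type.
Open Scope R_scope.

(** Write the curve as (x, tau), and scale the null normal field to (n / w, 1):
    then n is a unit tangent field of Q_c along x, and orthogonality to the curve
    reads <n, x'> = tau' / w = (theta o tau)'.  So, along n, the point x moves with
    exactly the speed of the parameter theta o tau, and following the geodesic of
    direction n backwards for the time theta o tau,
      gamma = cos_c(theta) x - sin_c(theta) n,
      nu = c sin_c(theta) x + cos_c(theta) n,
    removes this motion.  Write x' = (theta o tau)' n + y with y orthogonal to n;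
    y <> 0 because the curve is spacelike.

    The acceleration is collinear to the null field, hence orthogonal to it, and
    in the warped metric this means <n', x'> = - w' <y, y>
    (null_acceleration_equation, null_acceleration_rotation).  Together with the
    derivatives of <n, n> = 1 and <x, n> = 0 this determines n' completely:
    n' = - w' y - c (theta o tau)' x (unit_field_velocity).  Substituting,
      gamma' = (cos_c(theta) + w' sin_c(theta)) y,
      nu' = (c sin_c(theta) - w' cos_c(theta)) y
    (geodesic_rotation_velocity), so nu is normal to gamma, and the quotient of
    the two coefficients is - kappa.

    The null field is only assumed continuous, whereas gamma and nu have to be
    C^1.  But a unit vector n of a plane with a given product <n, x'> is
    determined up to a reflection by a quadratic equation with C^1 coefficients,
    whose discriminant is positive because the curve is spacelike;
    continuity selects one of the two solutions (C1_at_unit_field). *)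

(** * Functions of class C^1 at a point *)

(** The derivative is carried as a witness: sums, products and compositions
    then only need the differentiation rules on a neighbourhood. *)
Definition C1_at (f : R -> R) (s : R) : Prop :=
  exists f' : R -> R, locally s (fun r => is_derive f r (f' r)) /\ continuous f' s.

Lemma C1_at_ext_loc (f h : R -> R) (s : R) :
  locally s (fun r => f r = h r) -> C1_at f s -> C1_at h s.
Proof.
intros E [f' [D C]]; exists f'; split; [|exact C].
apply locally_locally in E.
generalize (filter_and _ _ E D); apply filter_imp.
intros r [Er Dr]; exact (is_derive_ext_loc f h r _ Er Dr).
Qed.

Lemma C1_at_locally_ex (f : R -> R) (s : R) :
  C1_at f s -> locally s (fun r => ex_derive f r).
Proof.
intros [f' [D _]]; revert D; apply filter_imp; intros r Dr; exists (f' r); exact Dr.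
Qed.

Lemma C1_at_ex (f : R -> R) (s : R) : C1_at f s -> ex_derive f s.
Proof. intros H; exact (locally_singleton _ _ (C1_at_locally_ex f s H)). Qed.

Lemma C1_at_continuous (f : R -> R) (s : R) : C1_at f s -> continuous f s.
Proof. intros H; apply @ex_derive_continuous; exact (C1_at_ex f s H). Qed.

Lemma C1_at_Derive_continuous (f : R -> R) (s : R) :
  C1_at f s -> continuous (Derive f) s.
Proof.
intros [f' [D C]].
apply continuous_ext_loc with f'; [|exact C].
revert D; apply filter_imp; intros r Dr; symmetry; exact (is_derive_unique f r _ Dr).
Qed.

Lemma C1_at_of_ex (f : R -> R) (s : R) :
  locally s (fun r => ex_derive f r) -> continuous (Derive f) s -> C1_at f s.
Proof.
intros E C; exists (Derive f); split; [|exact C].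
revert E; apply filter_imp; intros r; apply Derive_correct.
Qed.

Lemma C1_at_const (k s : R) : C1_at (fun _ => k) s.
Proof.
exists (fun _ => 0); split; [|apply continuous_const].
apply filter_forall; intros r; exact (is_derive_const k r).
Qed.

Lemma C1_at_plus (f h : R -> R) (s : R) :
  C1_at f s -> C1_at h s -> C1_at (fun r => f r + h r) s.
Proof.
intros [f' [Df Cf]] [h' [Dh Ch]].
exists (fun r => f' r + h' r); split.
- generalize (filter_and _ _ Df Dh); apply filter_imp; intros r [A B].
  exact (is_derive_plus f h r _ _ A B).
- exact (continuous_plus f' h' s Cf Ch).
Qed.

Lemma is_derive_Rmult (f h : R -> R) (s df dh : R) :
  is_derive f s df -> is_derive h s dh ->
  is_derive (fun r => f r * h r) s (df * h s + f s * dh).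
Proof. intros A B; exact (is_derive_mult f h s df dh A B Rmult_comm). Qed.

Lemma C1_at_mult (f h : R -> R) (s : R) :
  C1_at f s -> C1_at h s -> C1_at (fun r => f r * h r) s.
Proof.
intros Hf Hh; generalize Hf Hh; intros [f' [Df Cf]] [h' [Dh Ch]].
exists (fun r => f' r * h r + f r * h' r); split.
- generalize (filter_and _ _ Df Dh); apply filter_imp; intros r [A B].
  exact (is_derive_Rmult f h r _ _ A B).
- apply (continuous_plus (fun r => f' r * h r) (fun r => f r * h' r)).
  + exact (continuous_mult f' h s Cf (C1_at_continuous h s Hh)).
  + exact (continuous_mult f h' s (C1_at_continuous f s Hf) Ch).
Qed.

Lemma C1_at_opp (f : R -> R) (s : R) : C1_at f s -> C1_at (fun r => - f r) s.
Proof.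
intros H; apply C1_at_ext_loc with (fun r => -1 * f r).
- apply filter_forall; intros r; cbv beta; ring.
- apply C1_at_mult; [apply C1_at_const | exact H].
Qed.

Lemma C1_at_minus (f h : R -> R) (s : R) :
  C1_at f s -> C1_at h s -> C1_at (fun r => f r - h r) s.
Proof. intros A B; apply C1_at_plus; [exact A | apply C1_at_opp; exact B]. Qed.

Lemma C1_at_comp (f u : R -> R) (s : R) :
  C1_at f (u s) -> C1_at u s -> C1_at (fun r => f (u r)) s.
Proof.
intros [f' [Df Cf]] Hu; generalize Hu; intros [u' [Du Cu]].
exists (fun r => u' r * f' (u r)); split.
- assert (Du' : locally s (fun r => is_derive f (u r) (f' (u r)))).
  { exact (C1_at_continuous u s Hu _ Df). }
  generalize (filter_and _ _ Du' Du).
  apply filter_imp; intros r [A B]; exact (is_derive_comp f u r _ _ A B).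
- apply (continuous_mult u' (fun r => f' (u r)) s Cu).
  exact (continuous_comp u f' s (C1_at_continuous u s Hu) Cf).
Qed.

Lemma C1_at_Rinv (x : R) : x <> 0 -> C1_at Rinv x.
Proof.
intros Hx.
assert (L : locally x (fun r => r <> 0)).
{ apply (open_neq 0 x Hx). }
exists (fun r => - 1 / r ^ 2); split.
- revert L; apply filter_imp; intros r Hr.
  exact (is_derive_inv (fun y => y) r 1 (is_derive_id r) Hr).
- apply @ex_derive_continuous; auto_derive; simpl.
  intros E; apply Hx; nra.
Qed.

Lemma C1_at_inv (f : R -> R) (s : R) :
  C1_at f s -> f s <> 0 -> C1_at (fun r => / f r) s.
Proof. intros H E; exact (C1_at_comp Rinv f s (C1_at_Rinv _ E) H). Qed.

Lemma C1_at_div (f h : R -> R) (s : R) :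
  C1_at f s -> C1_at h s -> h s <> 0 -> C1_at (fun r => f r / h r) s.
Proof. intros A B E; apply C1_at_mult; [exact A | apply C1_at_inv; assumption]. Qed.

Lemma C1_at_Rsqrt (x : R) : 0 < x -> C1_at sqrt x.
Proof.
intros Hx.
exists (fun r => 1 / (2 * sqrt r)); split.
- generalize (open_gt 0 x Hx); apply filter_imp; intros r Hr.
  exact (is_derive_sqrt (fun y => y) r 1 (is_derive_id r) Hr).
- apply @ex_derive_continuous; auto_derive.
  pose proof (sqrt_lt_R0 x Hx); split; [exact Hx | split; [lra | exact I]].
Qed.

(** Near s the function has a constant sign, so it is plus or minus the square
    root of its square there.  This turns mere continuity of the null direction
    into differentiability. *)
Lemma C1_at_of_sqr (f : R -> R) (s : R) :
  continuous f s -> f s <> 0 -> C1_at (fun r => f r * f r) s -> C1_at f s.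
Proof.
intros C E H.
assert (S : C1_at (fun r => sqrt (f r * f r)) s).
{ apply (C1_at_comp sqrt (fun r => f r * f r) s); [|exact H].
  apply C1_at_Rsqrt; nra. }
destruct (Rtotal_order (f s) 0) as [L|[L|L]].
- apply C1_at_ext_loc with (fun r => - sqrt (f r * f r)).
  + assert (N : locally s (fun r => f r < 0)) by exact (C _ (open_lt 0 (f s) L)).
    revert N; apply filter_imp; intros r Hr.
    replace (f r * f r) with ((- f r) * (- f r)) by ring.
    rewrite sqrt_square; lra.
  + exact (C1_at_opp _ s S).
- contradiction.
- apply C1_at_ext_loc with (fun r => sqrt (f r * f r)); [|exact S].
  assert (N : locally s (fun r => 0 < f r)) by exact (C _ (open_gt 0 (f s) L)).
  revert N; apply filter_imp; intros r Hr.
  apply sqrt_square; lra.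
Qed.

(** * Regularity on an interval *)

Lemma open_interval_open (a b : Rbar) (t : R) :
  open_interval a b t -> locally t (open_interval a b).
Proof.
intros [A B].
exact (filter_and _ _ (open_Rbar_gt a t A) (open_Rbar_lt b t B)).
Qed.

Lemma C_on_of_C1_at (D : R -> Prop) (f : R -> R) :
  (forall s, D s -> C1_at f s) -> C_on D 1 f.
Proof.
intros H s Hs; split.
- intros [|[|k]] Hk; [exact I | exact (C1_at_ex f s (H s Hs)) | lia].
- exact (C1_at_Derive_continuous f s (H s Hs)).
Qed.

Lemma C1_at_of_C_on (a b : Rbar) (f : R -> R) (s : R) :
  C_on (open_interval a b) 1 f -> open_interval a b s -> C1_at f s.
Proof.
intros H Hs; apply C1_at_of_ex; [|exact (proj2 (H s Hs))].
generalize (open_interval_open a b s Hs); apply filter_imp; intros r Hr.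
exact (proj1 (H r Hr) 1%nat (le_n 1)).
Qed.

Lemma C1_at_of_C_on_2 (a b : Rbar) (f : R -> R) (s : R) :
  C_on (open_interval a b) 2 f -> open_interval a b s -> C1_at f s.
Proof.
intros H; apply C1_at_of_C_on.
intros r Hr; destruct (H r Hr) as [E _]; split.
- intros k Hk; apply E; lia.
- apply @ex_derive_continuous; exact (E 2%nat (le_n 2)).
Qed.

Lemma C1_at_Derive_of_C_on_2 (a b : Rbar) (f : R -> R) (s : R) :
  C_on (open_interval a b) 2 f -> open_interval a b s -> C1_at (Derive f) s.
Proof.
intros H Hs; apply C1_at_of_ex; [|exact (proj2 (H s Hs))].
generalize (open_interval_open a b s Hs); apply filter_imp; intros r Hr.
exact (proj1 (H r Hr) 2%nat (le_n 2)).
Qed.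

(** Differentiating a constraint such as <x, x> = c along a curve. *)
Lemma is_derive_locally_const (f : R -> R) (s k d : R) :
  locally s (fun r => f r = k) -> is_derive f s d -> d = 0.
Proof.
intros E D; rewrite <- (is_derive_unique f s d D).
rewrite (Derive_ext_loc f (fun _ => k) s E); apply Derive_const.
Qed.

(** * The functions cos_c, sin_c and theta *)

Lemma cos_sin_c (c : Z) (t : R) :
  (c = (-1)%Z \/ c = 0%Z \/ c = 1%Z) ->
  cos_c c t * cos_c c t + IZR c * (sin_c c t * sin_c c t) = 1.
Proof.
intros [->|[->| ->]]; simpl.
- unfold cosh, sinh; pose proof (exp_plus t (-t)) as E.
  rewrite Rplus_opp_r, exp_0 in E; nra.
- ring.
- pose proof (sin2_cos2 t); unfold Rsqr in *; lra.
Qed.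

Lemma is_derive_cos_c (c : Z) (t : R) :
  (c = (-1)%Z \/ c = 0%Z \/ c = 1%Z) ->
  is_derive (cos_c c) t (- IZR c * sin_c c t).
Proof.
intros [->|[->| ->]].
- apply is_derive_Reals; replace (- -1 * sin_c (-1) t) with (sinh t) by (simpl; ring).
  apply derivable_pt_lim_cosh.
- replace (- 0 * sin_c 0 t) with 0 by ring; exact (is_derive_const 1 t).
- apply is_derive_Reals; replace (- (1) * sin_c 1 t) with (- sin t) by (simpl; ring).
  apply derivable_pt_lim_cos.
Qed.

Lemma is_derive_sin_c (c : Z) (t : R) :
  (c = (-1)%Z \/ c = 0%Z \/ c = 1%Z) -> is_derive (sin_c c) t (cos_c c t).
Proof.
intros [->|[->| ->]].
- apply is_derive_Reals, derivable_pt_lim_sinh.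
- exact (is_derive_id t).
- apply is_derive_Reals, derivable_pt_lim_sin.
Qed.

Lemma C1_at_cos_c (c : Z) (t : R) :
  (c = (-1)%Z \/ c = 0%Z \/ c = 1%Z) -> C1_at (cos_c c) t.
Proof.
intros Hc; exists (fun r => - IZR c * sin_c c r); split.
- apply filter_forall; intros r; exact (is_derive_cos_c c r Hc).
- apply (continuous_mult (fun _ => - IZR c) (sin_c c)); [apply continuous_const|].
  apply @ex_derive_continuous; eexists; exact (is_derive_sin_c c t Hc).
Qed.

Lemma C1_at_sin_c (c : Z) (t : R) :
  (c = (-1)%Z \/ c = 0%Z \/ c = 1%Z) -> C1_at (sin_c c) t.
Proof.
intros Hc; exists (cos_c c); split.
- apply filter_forall; intros r; exact (is_derive_sin_c c r Hc).
- apply C1_at_continuous; exact (C1_at_cos_c c t Hc).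
Qed.

Lemma is_derive_theta (a b : Rbar) (w : R -> R) (t0 t : R) :
  (forall r, open_interval a b r -> continuous w r) ->
  (forall r, open_interval a b r -> 0 < w r) ->
  open_interval a b t0 -> open_interval a b t ->
  is_derive (theta w t0) t (/ w t).
Proof.
intros C P H0 Ht.
assert (CI : forall r, open_interval a b r -> continuous (fun r => / w r) r).
{ intros r Hr; apply (continuous_comp w Rinv r (C r Hr)), C1_at_continuous, C1_at_Rinv.
  apply Rgt_not_eq, P, Hr. }
apply (is_derive_RInt (fun s => / w s) (theta w t0) t0 t); [|exact (CI t Ht)].
generalize (open_interval_open a b t Ht); apply filter_imp; intros r Hr.
apply (RInt_correct (V := R_CompleteNormedModule)), ex_RInt_continuous.
intros z [Hz1 Hz2]; apply CI.
destruct H0 as [A0 B0], Hr as [A B].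
split.
- apply Rbar_lt_le_trans with (Rmin t0 r); [|exact Hz1].
  unfold Rmin; destruct Rle_dec; assumption.
- apply Rbar_le_lt_trans with (Rmax t0 r); [exact Hz2|].
  unfold Rmax; destruct Rle_dec; assumption.
Qed.

(** * Tangent planes of the space forms *)

(** A normal vector of Q_c at x in R^3: x itself on the two quadrics, and e3 on
    the plane x3 = 0. *)
Definition normal_Q (c : Z) (x : vec) : vec :=
  match c with
  | Z0 => fun i => match i with X3 => 1 | _ => 0 end
  | _ => x
  end.

(** The rotation by a right angle in the tangent plane at x, namely the cross
    product with the normal vector; the factor sgn makes it the cross product
    of the Lorentzian metric when c = -1. *)
Definition rot (c : Z) (x v : vec) : vec := fun i =>
  sgn c i *
  match i with
  | X1 => normal_Q c x X2 * v X3 - normal_Q c x X3 * v X2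
  | X2 => normal_Q c x X3 * v X1 - normal_Q c x X1 * v X3
  | X3 => normal_Q c x X1 * v X2 - normal_Q c x X2 * v X1
  end.

(** For v <> 0 the pair (v, rot v) is an orthogonal basis of the tangent plane,
    both vectors having the square <v, v>; this is the expansion of u in it,
    with the denominators cleared. *)
Lemma rot_decomp (c : Z) (x u v : vec) (i : axis) :
  in_Q c x -> tangent_Q c x u -> tangent_Q c x v ->
  inner c v v * u i = inner c u v * v i + inner c u (rot c x v) * rot c x v i.
Proof.
destruct c; unfold inner, rot; simpl; intros Hx Hu Hv.
- destruct i; rewrite ?Hu, ?Hv; ring.
- simpl in *; unfold inner in *; simpl in *; destruct i; nsatz.
- unfold inner in *; destruct Hx as [Hx _]; simpl in *; destruct i; nsatz.
Qed.

Lemma inner_rot_decomp (c : Z) (x u v z : vec) :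
  in_Q c x -> tangent_Q c x u -> tangent_Q c x v ->
  inner c v v * inner c u z =
  inner c u v * inner c v z + inner c u (rot c x v) * inner c (rot c x v) z.
Proof.
intros Hx Hu Hv.
pose proof (rot_decomp c x u v X1 Hx Hu Hv) as E1.
pose proof (rot_decomp c x u v X2 Hx Hu Hv) as E2.
pose proof (rot_decomp c x u v X3 Hx Hu Hv) as E3.
transitivity (sgn c X1 * (inner c v v * u X1) * z X1 + sgn c X2 * (inner c v v * u X2) * z X2
  + sgn c X3 * (inner c v v * u X3) * z X3); [unfold inner; ring|].
rewrite E1, E2, E3; unfold inner; ring.
Qed.

(** With respect to the orthonormal basis (n, rot n), y and z are both multiples
    of rot n, and that of y is nonzero. *)
Lemma tangent_orthogonal_zero (c : Z) (x n y z : vec) :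
  in_Q c x -> tangent_Q c x n -> tangent_Q c x y -> tangent_Q c x z ->
  inner c n n = 1 -> inner c y n = 0 -> inner c y y <> 0 ->
  inner c z n = 0 -> inner c z y = 0 -> forall i, z i = 0.
Proof.
intros Hx Hn Hy Hz Enn Eyn Eyy Ezn Ezy i.
pose proof (inner_rot_decomp c x y n y Hx Hy Hn) as A.
pose proof (inner_rot_decomp c x z n y Hx Hz Hn) as B.
pose proof (rot_decomp c x z n i Hx Hz Hn) as D.
rewrite Enn, Eyn in A; rewrite Enn, Ezn, Ezy in B; rewrite Enn, Ezn in D.
set (a := inner c (rot c x n) y) in *.
assert (a <> 0) by (intros E; apply Eyy; rewrite E in A; lra).
assert (Z0' : inner c z (rot c x n) = 0).
{ apply Rmult_eq_reg_r with a; [lra | assumption]. }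
rewrite Z0' in D; lra.
Qed.

(** Tangent planes are spacelike, also in the Lorentzian ambient space. *)
Lemma tangent_null_zero (c : Z) (x v : vec) :
  in_Q c x -> tangent_Q c x v -> inner c v v = 0 -> forall i, v i = 0.
Proof.
intros Hx Hv Ev.
assert (H12 : v X1 = 0 /\ v X2 = 0).
{ assert (E : v X1 * v X1 + v X2 * v X2 <= 0).
  { destruct c; simpl in *; unfold inner in *; simpl in *.
    - rewrite Hv in Ev; lra.
    - pose proof (Rle_0_sqr (v X3)); unfold Rsqr in *; lra.
    - (* x is timelike: its horizontal part is shorter than |x3|, so
         Cauchy-Schwarz leaves no room for a nonzero null tangent vector *)
      destruct Hx as [Hx Px].
      pose proof (Rle_0_sqr (v X1 * x X2 - v X2 * x X1)) as CS; unfold Rsqr in CS.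
      assert (E3 : v X3 * x X3 = v X1 * x X1 + v X2 * x X2) by lra.
      assert (x X3 * x X3 * (v X3 * v X3) =
              (v X1 * x X1 + v X2 * x X2) * (v X1 * x X1 + v X2 * x X2)).
      { rewrite <- E3; ring. }
      assert (Evv : v X3 * v X3 = v X1 * v X1 + v X2 * v X2) by lra.
      assert (Exx : x X3 * x X3 = 1 + (x X1 * x X1 + x X2 * x X2)) by lra.
      rewrite Evv, Exx in H; nra. }
  split; nra. }
destruct H12 as [H1 H2].
assert (H3 : v X3 = 0).
{ destruct c; simpl in *; unfold inner in *; simpl in *; rewrite ?H1, ?H2 in *.
  - exact Hv.
  - nra.
  - nra. }
intros []; assumption.
Qed.

(** The factor c makes this and the next lemma uniform in c: in the flat plane
    neither inner product is controlled, but there it always occurs with the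
    factor c = 0. *)
Lemma tangent_Q_inner (c : Z) (x v : vec) :
  tangent_Q c x v -> IZR c * inner c x v = 0.
Proof. destruct c; simpl; intros H; rewrite ?H; ring. Qed.

Lemma in_Q_inner (c : Z) (x : vec) :
  (c = (-1)%Z \/ c = 0%Z \/ c = 1%Z) -> in_Q c x ->
  IZR c * inner c x x = IZR c * IZR c.
Proof.
intros [->|[->| ->]]; simpl.
- intros [H _]; rewrite H; ring.
- intros _; ring.
- intros H; rewrite H; ring.
Qed.

Lemma inner_sym (c : Z) (x y : vec) : inner c x y = inner c y x.
Proof. unfold inner; ring. Qed.

Lemma inner_combination_r (c : Z) (x u v : vec) (k l : R) :
  inner c x (fun i => k * u i + l * v i) = k * inner c x u + l * inner c x v.
Proof. unfold inner; ring. Qed.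

Lemma inner_combination_l (c : Z) (x u v : vec) (k l : R) :
  inner c (fun i => k * u i + l * v i) x = k * inner c u x + l * inner c v x.
Proof. unfold inner; ring. Qed.

Lemma tangent_Q_combination (c : Z) (x u v : vec) (k l : R) :
  tangent_Q c x u -> tangent_Q c x v -> tangent_Q c x (fun i => k * u i + l * v i).
Proof.
destruct c; simpl; intros Hu Hv; rewrite ?inner_combination_r, Hu, Hv; ring.
Qed.

(** The geodesic from x with initial velocity - n.  On the hyperboloid the upper
    sheet is not left, because |n3| < x3 by Cauchy-Schwarz. *)
Lemma in_Q_geodesic (c : Z) (x n : vec) (t : R) :
  (c = (-1)%Z \/ c = 0%Z \/ c = 1%Z) ->
  in_Q c x -> tangent_Q c x n -> inner c n n = 1 ->
  in_Q c (fun i => cos_c c t * x i + - sin_c c t * n i).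
Proof.
intros Hc Hx Hn Enn; pose proof (cos_sin_c c t Hc) as CS.
destruct Hc as [->|[->| ->]]; simpl in *.
- destruct Hx as [Hx Px]; split.
  + rewrite inner_combination_l, !inner_combination_r, (inner_sym _ n x), Hx, Hn, Enn; lra.
  + assert (S : n X3 * n X3 < x X3 * x X3).
    { simpl in *; unfold inner in *; simpl in *.
      pose proof (Rle_0_sqr (n X1 * x X2 - n X2 * x X1)) as L; unfold Rsqr in L.
      assert (E3 : n X3 * x X3 = n X1 * x X1 + n X2 * x X2) by lra.
      assert (E : (n X3 * n X3) * (x X3 * x X3) =
              (n X1 * x X1 + n X2 * x X2) * (n X1 * x X1 + n X2 * x X2)).
      { rewrite <- E3; ring. }
      assert (Eh : n X1 * n X1 + n X2 * n X2 = 1 + n X3 * n X3) by lra.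
      assert (Exx : x X1 * x X1 + x X2 * x X2 = x X3 * x X3 - 1) by lra.
      assert (L' : (n X3 * n X3) * (x X3 * x X3) <= (1 + n X3 * n X3) * (x X3 * x X3 - 1)).
      { rewrite E, <- Eh, <- Exx; nra. }
      nra. }
    assert (N : - x X3 < n X3 < x X3) by (split; nra).
    pose proof (exp_pos t); pose proof (exp_pos (- t)).
    unfold cosh, sinh; nra.
- rewrite Hx, Hn; ring.
- rewrite inner_combination_l, !inner_combination_r, (inner_sym _ n x), Hx, Hn, Enn; lra.
Qed.

(** * Covariant derivatives in the warped product *)

Lemma dotw_eq (c : Z) (w : R -> R) (p X Y : pt) :
  dotw c w p X Y =
  w (p None) ^ 2 * inner c (space X) (space Y) - X None * Y None.
Proof.
unfold dotw, sum_coord, metric, inner, space; simpl; ring.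
Qed.

Lemma partial_metric_space (c : Z) (w : R -> R) (p : pt) (i : axis) (k l : coord) :
  partial (Some i) (fun q => metric c w q k l) p = 0.
Proof.
unfold partial.
rewrite (Derive_ext _ (fun _ => metric c w p k l)); [apply Derive_const|].
intros h; reflexivity.
Qed.

Lemma partial_metric_time (c : Z) (w : R -> R) (p : pt) (k l : coord) :
  ex_derive w (p None) ->
  partial None (fun q => metric c w q k l) p =
  if coord_eq_dec k l then
    match k with
    | Some i => 2 * w (p None) * Derive w (p None) * sgn c i
    | None => 0
    end
  else 0.
Proof.
intros Hw; unfold partial, metric.
destruct (coord_eq_dec k l); [|apply Derive_const].
destruct k as [i|]; [|apply Derive_const].
simpl; apply is_derive_unique; auto_derive.
- rewrite Rplus_0_r; repeat (split; [exact Hw|]); exact I.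
- rewrite Rplus_0_r; change (Derive (fun x : R => w x)) with (Derive w); ring.
Qed.

Lemma christoffel_eq (c : Z) (w : R -> R) (p : pt) (k i j : coord) :
  ex_derive w (p None) -> w (p None) <> 0 ->
  christoffel c w p k i j =
  match k, i, j with
  | Some d, None, Some e | Some d, Some e, None =>
      if coord_eq_dec (Some d) (Some e) then Derive w (p None) / w (p None) else 0
  | None, Some d, Some e =>
      if coord_eq_dec (Some d) (Some e)
      then w (p None) * Derive w (p None) * sgn c d else 0
  | _, _, _ => 0
  end.
Proof.
intros Hw Pw; unfold christoffel.
assert (Hs : forall d, sgn c d <> 0).
{ intros d; destruct c, d; simpl; lra. }
destruct k as [k|], i as [i|], j as [j|];
  rewrite ?partial_metric_space, ?partial_metric_time by exact Hw.
all: try (destruct k); try (destruct i); try (destruct j); unfold metric; simpl; try ring; try field.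
all: try (repeat split; auto; lra).
Qed.

Lemma cov_ambient_space (c : Z) (w : R -> R) (g X : R -> pt) (s : R) (i : axis) :
  ex_derive w (g s None) -> w (g s None) <> 0 ->
  cov_ambient c w g X s (Some i) =
  velocity X s (Some i) + Derive w (g s None) / w (g s None) *
    (velocity g s None * X s (Some i) + velocity g s (Some i) * X s None).
Proof.
intros Hw Pw; unfold cov_ambient, sum_coord.
rewrite !christoffel_eq by assumption.
destruct i; simpl; ring.
Qed.

Lemma cov_ambient_time (c : Z) (w : R -> R) (g X : R -> pt) (s : R) :
  ex_derive w (g s None) -> w (g s None) <> 0 ->
  cov_ambient c w g X s None =
  velocity X s None + w (g s None) * Derive w (g s None) *
    inner c (space (velocity g s)) (space (X s)).
Proof.
intros Hw Pw; unfold cov_ambient, sum_coord.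
rewrite !christoffel_eq by assumption.
unfold inner, space; simpl; ring.
Qed.

(** The projection removes a multiple of x, to which N is orthogonal. *)
Lemma dotw_cov (c : Z) (w : R -> R) (g X : R -> pt) (s : R) (N : pt) :
  tangent_Q c (space (g s)) (space N) ->
  dotw c w (g s) (cov c w g X s) N = dotw c w (g s) (cov_ambient c w g X s) N.
Proof.
intros HN; apply tangent_Q_inner in HN.
rewrite !dotw_eq; unfold cov at 2.
f_equal; f_equal.
transitivity (inner c (space (cov_ambient c w g X s)) (space N)
  - (IZR c * inner c (space (g s)) (space N))
    * inner c (space (g s)) (space (cov_ambient c w g X s))).
- unfold inner, cov, proj_Q, space, inner; ring.
- rewrite HN; ring.
Qed.

(** * The equation of null acceleration *)

Lemma C1_at_inner (c : Z) (u v : R -> vec) (s : R) :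
  (forall i, C1_at (fun r => u r i) s) -> (forall i, C1_at (fun r => v r i) s) ->
  C1_at (fun r => inner c (u r) (v r)) s.
Proof.
intros Hu Hv.
assert (T : forall i, C1_at (fun r => sgn c i * u r i * v r i) s).
{ intros i; apply (C1_at_mult (fun r => sgn c i * u r i)); [|apply Hv].
  apply (C1_at_mult (fun _ => sgn c i)); [apply C1_at_const | apply Hu]. }
exact (C1_at_plus _ _ s (C1_at_plus _ _ s (T X1) (T X2)) (T X3)).
Qed.

Lemma is_derive_inner (c : Z) (u v : R -> vec) (s : R) (du dv : vec) :
  (forall i, is_derive (fun r => u r i) s (du i)) ->
  (forall i, is_derive (fun r => v r i) s (dv i)) ->
  is_derive (fun r => inner c (u r) (v r)) s (inner c du (v s) + inner c (u s) dv).
Proof.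
intros Hu Hv.
assert (T : forall i, is_derive (fun r => sgn c i * u r i * v r i) s
  (sgn c i * du i * v s i + sgn c i * u s i * dv i)).
{ intros i; apply (is_derive_Rmult (fun r => sgn c i * u r i)); [|apply Hv].
  exact (is_derive_scal (fun r => u r i) s (sgn c i) (du i) (Hu i)). }
unfold inner.
replace (_ + _ + _ + _) with
  ((sgn c X1 * du X1 * v s X1 + sgn c X1 * u s X1 * dv X1)
   + (sgn c X2 * du X2 * v s X2 + sgn c X2 * u s X2 * dv X2)
   + (sgn c X3 * du X3 * v s X3 + sgn c X3 * u s X3 * dv X3)) by ring.
exact (is_derive_plus _ _ s _ _ (is_derive_plus _ _ s _ _ (T X1) (T X2)) (T X3)).
Qed.

Lemma C1_at_speed (c : Z) (w : R -> R) (g : R -> pt) (s : R) :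
  C1_at w (g s None) -> (forall k, C1_at (fun r => g r k) s) ->
  (forall k, C1_at (fun r => velocity g r k) s) ->
  0 < dotw c w (g s) (velocity g s) (velocity g s) ->
  C1_at (speed c w g) s.
Proof.
intros Hw Hg Hv P.
apply (C1_at_comp sqrt (fun r => dotw c w (g r) (velocity g r) (velocity g r)) s).
- exact (C1_at_Rsqrt _ P).
- apply C1_at_ext_loc with (fun r =>
    w (g r None) * w (g r None) * inner c (space (velocity g r)) (space (velocity g r))
    - velocity g r None * velocity g r None).
  + apply filter_forall; intros r; rewrite dotw_eq; ring.
  + assert (W : C1_at (fun r => w (g r None)) s).
    { exact (C1_at_comp w (fun r => g r None) s Hw (Hg None)). }
    apply C1_at_minus; [|apply C1_at_mult; apply Hv].
    apply C1_at_mult; [apply C1_at_mult; exact W|].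
    apply C1_at_inner; intros i; apply Hv.
Qed.

(** Normalising the velocity changes its derivative by the factor 1 / speed and a
    tangential term, which vectors orthogonal to the curve do not see. *)
Lemma unit_tangent_velocity (c : Z) (w : R -> R) (g : R -> pt) (s : R) :
  (forall k, C1_at (fun r => velocity g r k) s) -> C1_at (speed c w g) s ->
  speed c w g s <> 0 ->
  exists m, forall k, velocity (unit_tangent c w g) s k =
    velocity (velocity g) s k / speed c w g s + m * velocity g s k.
Proof.
intros Hv Hs Ps.
pose proof (C1_at_ex _ _ (C1_at_inv _ _ Hs Ps)) as Hi.
exists (Derive (fun r => / speed c w g r) s); intros k.
apply is_derive_unique.
replace (_ + _) with (velocity (velocity g) s k * / speed c w g s
  + velocity g s k * Derive (fun r => / speed c w g r) s) by (unfold Rdiv; ring).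
apply (is_derive_Rmult (fun r => velocity g r k) (fun r => / speed c w g r));
  apply Derive_correct.
- exact (C1_at_ex _ _ (Hv k)).
- exact Hi.
Qed.

(** An acceleration collinear to the null vector N is orthogonal to N; as N is
    orthogonal to the curve, the same holds for the derivative of the velocity
    in any parametrization. *)
Lemma null_acceleration_equation (c : Z) (w : R -> R) (g : R -> pt) (s : R) (N : pt) (f : R) :
  C1_at w (g s None) -> w (g s None) <> 0 -> (forall k, C1_at (fun r => g r k) s) ->
  (forall k, C1_at (fun r => velocity g r k) s) ->
  0 < dotw c w (g s) (velocity g s) (velocity g s) ->
  tangent_Q c (space (g s)) (space N) ->
  dotw c w (g s) N N = 0 ->
  dotw c w (g s) N (velocity g s) = 0 ->
  (forall k, acceleration c w g s k = f * N k) ->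
  dotw c w (g s) (cov_ambient c w g (velocity g) s) N = 0.
Proof.
intros Hw Pw Hg Hv P HN ENN ENv Hacc.
assert (Ps : 0 < speed c w g s) by (apply sqrt_lt_R0; exact P).
assert (Ps' : speed c w g s <> 0) by lra.
destruct (unit_tangent_velocity c w g s Hv (C1_at_speed c w g s Hw Hg Hv P) Ps') as [m Hm].
pose proof (C1_at_ex _ _ Hw) as Dw.
assert (E : dotw c w (g s) (cov c w g (unit_tangent c w g) s) N = 0).
{ replace 0 with (speed c w g s * f * dotw c w (g s) N N) by (rewrite ENN; ring).
  assert (Hc : forall k, cov c w g (unit_tangent c w g) s k = speed c w g s * f * N k).
  { intros k; specialize (Hacc k); unfold acceleration in Hacc.
    apply Rmult_eq_reg_r with (/ speed c w g s); [|apply Rinv_neq_0_compat; exact Ps'].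
    fold (Rdiv (cov c w g (unit_tangent c w g) s k) (speed c w g s)).
    rewrite Hacc; field; exact Ps'. }
  rewrite !dotw_eq; unfold inner, space; rewrite !Hc; ring. }
rewrite dotw_cov in E by exact HN.
assert (L : forall k, cov_ambient c w g (unit_tangent c w g) s k =
  cov_ambient c w g (velocity g) s k / speed c w g s + m * velocity g s k).
{ intros [i|].
  - rewrite !cov_ambient_space, Hm by assumption; unfold unit_tangent; field; auto.
  - rewrite !cov_ambient_time, Hm by assumption.
    unfold inner, space, unit_tangent; field; auto. }
assert (E' : dotw c w (g s) (cov_ambient c w g (velocity g) s) N / speed c w g s
  + m * dotw c w (g s) N (velocity g s) = 0).
{ rewrite <- E, !dotw_eq; unfold inner, space; rewrite !L; field; exact Ps'. }
rewrite ENv in E'.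
apply Rmult_eq_reg_r with (/ speed c w g s); [|apply Rinv_neq_0_compat; exact Ps'].
unfold Rdiv in E'; lra.
Qed.

(** * The unit direction of a null normal field *)

(** A null vector without time component would be a null tangent vector of the
    Riemannian surface Q_c. *)
Lemma null_normal_time (c : Z) (w : R -> R) (p N : pt) :
  in_Q c (space p) -> w (p None) <> 0 -> tangent_Q c (space p) (space N) ->
  dotw c w p N N = 0 -> (exists k, N k <> 0) -> N None <> 0.
Proof.
intros Hp Pw HN ENN [k Hk] E0; rewrite dotw_eq, E0 in ENN.
assert (E : inner c (space N) (space N) = 0).
{ apply Rmult_eq_reg_l with (w (p None) ^ 2); [lra | apply pow_nonzero; exact Pw]. }
pose proof (tangent_null_zero c (space p) (space N) Hp HN E) as Z.
destruct k as [i|]; [exact (Hk (Z i)) | exact (Hk E0)].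
Qed.

Lemma tangent_Q_scal (c : Z) (x v : vec) (k : R) :
  tangent_Q c x v -> tangent_Q c x (fun i => k * v i).
Proof.
destruct c as [|d|d]; simpl; intros Hv; [rewrite Hv; ring| |].
- transitivity (k * inner (Z.pos d) x v); [unfold inner; ring | rewrite Hv; ring].
- transitivity (k * inner (Z.neg d) x v); [unfold inner; ring | rewrite Hv; ring].
Qed.

(** Up to scaling, N is the null vector (n / w, 1) with n a unit tangent vector of
    Q_c, and its orthogonality to the curve prescribes the component of the
    space velocity along n. *)
Lemma null_direction_unit (c : Z) (w : R -> R) (p v N : pt) :
  w (p None) <> 0 -> N None <> 0 ->
  dotw c w p N N = 0 -> dotw c w p N v = 0 ->
  let n := fun i => w (p None) / N None * N (Some i) in
  inner c n n = 1 /\ inner c n (space v) = v None / w (p None).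
Proof.
rewrite !dotw_eq; intros Pw PN ENN ENv n; unfold n; split.
- transitivity (w (p None) ^ 2 * inner c (space N) (space N) / (N None * N None)).
  + unfold inner, space; field; exact PN.
  + replace (w (p None) ^ 2 * inner c (space N) (space N)) with (N None * N None) by lra.
    field; exact PN.
- transitivity (w (p None) ^ 2 * inner c (space N) (space v) / (w (p None) * N None)).
  + unfold inner, space; field; auto.
  + replace (w (p None) ^ 2 * inner c (space N) (space v)) with (N None * v None) by lra.
    field; auto.
Qed.

Lemma C1_at_rot (c : Z) (x v : R -> vec) (s : R) (i : axis) :
  (forall j, C1_at (fun r => x r j) s) -> (forall j, C1_at (fun r => v r j) s) ->
  C1_at (fun r => rot c (x r) (v r) i) s.
Proof.
intros Hx Hv.
assert (Hm : forall j, C1_at (fun r => normal_Q c (x r) j) s).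
{ intros j; destruct c; simpl; [apply C1_at_const | apply Hx | apply Hx]. }
assert (T : forall j l, C1_at (fun r => normal_Q c (x r) j * v r l) s).
{ intros j l; exact (C1_at_mult _ _ s (Hm j) (Hv l)). }
apply (C1_at_mult (fun _ => sgn c i)); [apply C1_at_const|].
destruct i; exact (C1_at_minus _ _ s (T _ _) (T _ _)).
Qed.

Lemma continuous_inner (c : Z) (u v : R -> vec) (s : R) :
  (forall i, continuous (fun r => u r i) s) -> (forall i, continuous (fun r => v r i) s) ->
  continuous (fun r => inner c (u r) (v r)) s.
Proof.
intros Hu Hv.
assert (T : forall i, continuous (fun r => sgn c i * u r i * v r i) s).
{ intros i; apply (continuous_mult (fun r => sgn c i * u r i)); [|apply Hv].
  apply (continuous_mult (fun _ => sgn c i)); [apply continuous_const | apply Hu]. }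
exact (continuous_plus _ _ s (continuous_plus _ _ s (T X1) (T X2)) (T X3)).
Qed.

(** In the basis (v, rot v) the unit field n has the coefficients h / <v, v> and
    b / <v, v>, where b^2 = <v, v> - h^2 because n is unit.  So b^2 is C^1, and
    b is continuous and does not vanish, hence is C^1. *)
Lemma C1_at_unit_field (c : Z) (x v n : R -> vec) (h : R -> R) (s : R) :
  locally s (fun r => in_Q c (x r) /\ tangent_Q c (x r) (v r) /\ tangent_Q c (x r) (n r) /\
    inner c (n r) (n r) = 1 /\ inner c (n r) (v r) = h r) ->
  (forall i, C1_at (fun r => x r i) s) -> (forall i, C1_at (fun r => v r i) s) ->
  C1_at h s -> (forall i, continuous (fun r => n r i) s) ->
  h s * h s < inner c (v s) (v s) ->
  forall i, C1_at (fun r => n r i) s.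
Proof.
intros L Hx Hv Hh Cn Lt i.
set (b := fun r => inner c (n r) (rot c (x r) (v r))).
assert (Hvv : C1_at (fun r => inner c (v r) (v r)) s) by (apply C1_at_inner; exact Hv).
assert (Hr : forall j, C1_at (fun r => rot c (x r) (v r) j) s).
{ intros j; apply C1_at_rot; assumption. }
assert (Lb : locally s (fun r => inner c (v r) (v r) - h r * h r = b r * b r)).
{ revert L; apply filter_imp; intros r [Qx [Tv [Tn [Enn Env]]]].
  pose proof (inner_rot_decomp c (x r) (n r) (v r) (n r) Qx Tn Tv) as E.
  rewrite Enn, Env, (inner_sym c (v r) (n r)), Env, (inner_sym c (rot _ _ _) (n r)) in E.
  unfold b; lra. }
assert (Hb : C1_at b s).
{ apply C1_at_of_sqr.
  - apply continuous_inner; [exact Cn|].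
    intros j; apply C1_at_continuous; exact (Hr j).
  - intros E; pose proof (locally_singleton _ _ Lb) as F; cbv beta in F; rewrite E in F; lra.
  - apply C1_at_ext_loc with (fun r => inner c (v r) (v r) - h r * h r); [exact Lb|].
    exact (C1_at_minus _ _ s Hvv (C1_at_mult _ _ s Hh Hh)). }
assert (Pvv : 0 < inner c (v s) (v s)) by (pose proof (Rle_0_sqr (h s)); unfold Rsqr in *; lra).
apply C1_at_ext_loc with
  (fun r => (h r * v r i + b r * rot c (x r) (v r) i) / inner c (v r) (v r)).
- assert (Lp : locally s (fun r => 0 < inner c (v r) (v r))).
  { exact (C1_at_continuous _ s Hvv _ (open_gt 0 _ Pvv)). }
  generalize (filter_and _ _ L Lp); apply filter_imp.
  intros r [[Qx [Tv [Tn [Enn Env]]]] P].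
  pose proof (rot_decomp c (x r) (n r) (v r) i Qx Tn Tv) as E.
  rewrite Env in E; fold (b r) in E; rewrite <- E; field; lra.
- apply C1_at_div; [|exact Hvv | lra].
  exact (C1_at_plus _ _ s (C1_at_mult _ _ s Hh (Hv i)) (C1_at_mult _ _ s Hb (Hr i))).
Qed.

(** In the warped metric, <(n / w, 1), cov velocity> is the sum of w <n, x''> and
    of terms of first order.  Differentiating <n, x'> = tau' / w expresses
    <n, x''> through <n', x'>, and the second derivative of tau cancels. *)
Lemma null_acceleration_rotation (c : Z) (w : R -> R) (g : R -> pt) (n : R -> vec)
    (s : R) (N : pt) :
  C1_at w (g s None) -> w (g s None) <> 0 -> N None <> 0 ->
  (forall k, C1_at (fun r => g r k) s) ->
  (forall k, C1_at (fun r => velocity g r k) s) ->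
  (forall i, C1_at (fun r => n r i) s) ->
  (forall i, n s i = w (g s None) / N None * N (Some i)) ->
  locally s (fun r => velocity g r None =
    inner c (n r) (space (velocity g r)) * w (g r None)) ->
  dotw c w (g s) (cov_ambient c w g (velocity g) s) N = 0 ->
  inner c (vvelocity n s) (space (velocity g s)) =
  - Derive w (g s None) *
    (inner c (space (velocity g s)) (space (velocity g s))
     - inner c (n s) (space (velocity g s)) * inner c (n s) (space (velocity g s))).
Proof.
intros Hw Qn QN G1 G2 n1 En L E.
pose proof (C1_at_ex _ _ Hw) as Dw.
rewrite dotw_eq, cov_ambient_time in E by assumption.
set (v := fun r => space (velocity g r)).
set (A := space (velocity (velocity g) s)).
fold (v s) in E |- *.
assert (E1 : w (g s None) * inner c (n s) A
  + 2 * Derive w (g s None) * velocity g s None * inner c (n s) (v s)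
  - velocity (velocity g) s None
  - w (g s None) * Derive w (g s None) * inner c (v s) (v s) = 0).
{ apply Rmult_eq_reg_l with (N None); [|exact QN].
  rewrite Rmult_0_r, <- E.
  unfold A, v, inner, space; rewrite !cov_ambient_space, !En by assumption; field; auto. }
assert (Dn : forall i, is_derive (fun r => n r i) s (vvelocity n s i)).
{ intros i; apply Derive_correct, C1_at_ex, n1. }
assert (Dv : forall i, is_derive (fun r => v r i) s (A i)).
{ intros i; apply Derive_correct, C1_at_ex; exact (G2 (Some i)). }
assert (Dwt : is_derive (fun r => w (g r None)) s
  (velocity g s None * Derive w (g s None))).
{ apply (is_derive_comp w (fun r => g r None) s); [apply Derive_correct; exact Dw|].
  apply Derive_correct, C1_at_ex; exact (G1 None). }
assert (Dt : velocity (velocity g) s None =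
  (inner c (vvelocity n s) (v s) + inner c (n s) A) * w (g s None)
  + inner c (n s) (v s) * (velocity g s None * Derive w (g s None))).
{ apply is_derive_unique.
  apply is_derive_ext_loc with (fun r => inner c (n r) (v r) * w (g r None)).
  - revert L; apply filter_imp; intros r Er; symmetry; exact Er.
  - apply (is_derive_Rmult (fun r => inner c (n r) (v r)) (fun r => w (g r None)) s);
      [|exact Dwt].
    exact (is_derive_inner c n v s _ _ Dn Dv). }
rewrite Dt in E1.
pose proof (locally_singleton _ _ L) as Eh; cbv beta in Eh; fold (v s) in Eh.
rewrite Eh in E1.
apply Rmult_eq_reg_l with (w (g s None)); [lra | exact Qn].
Qed.

(** * Moving frames along a curve of the space form *)

Lemma tangent_Q_velocity (c : Z) (x : R -> vec) (dx : vec) (s : R) :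
  (c = (-1)%Z \/ c = 0%Z \/ c = 1%Z) ->
  locally s (fun r => in_Q c (x r)) ->
  (forall i, is_derive (fun r => x r i) s (dx i)) -> tangent_Q c (x s) dx.
Proof.
intros Hc L D.
pose proof (is_derive_inner c x x s dx dx D D) as Di; rewrite (inner_sym c dx) in Di.
destruct Hc as [->|[->| ->]]; simpl.
- assert (E : inner (-1) (x s) dx + inner (-1) (x s) dx = 0); [|lra].
  apply (is_derive_locally_const _ s (-1) _) with (2 := Di).
  revert L; apply filter_imp; intros r [H _]; exact H.
- exact (is_derive_locally_const (fun r => x r X3) s 0 _ L (D X3)).
- assert (E : inner 1 (x s) dx + inner 1 (x s) dx = 0); [|lra].
  exact (is_derive_locally_const _ s 1 _ L Di).
Qed.

(** Here y is the component of dx orthogonal to n.  The inner products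
    of dn with n and y are 0, by differentiating <n, n> = 1, and - k <y, y>; its
    part normal to Q_c comes from differentiating the tangency of n, which for
    c <> 0 gives <x, dn> = - th.  Hence the difference z of the two sides is
    tangent at x and orthogonal to n and y, so it vanishes. *)
Lemma unit_field_velocity (c : Z) (x n : R -> vec) (dx dn y : vec) (th k s : R) :
  (c = (-1)%Z \/ c = 0%Z \/ c = 1%Z) ->
  locally s (fun r => in_Q c (x r) /\ tangent_Q c (x r) (n r) /\ inner c (n r) (n r) = 1) ->
  (forall i, is_derive (fun r => x r i) s (dx i)) ->
  (forall i, is_derive (fun r => n r i) s (dn i)) ->
  inner c (n s) dx = th -> (forall i, dx i = th * n s i + y i) ->
  inner c y y <> 0 -> inner c dn dx = - k * inner c y y ->
  tangent_Q c (x s) y /\ inner c (n s) y = 0 /\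
  (forall i, dn i = - k * y i - IZR c * th * x s i).
Proof.
intros Hc L Dx Dn Enx Edx Eyy Ek.
pose proof (locally_singleton _ _ L) as [Qx [Tn Enn]].
assert (Tx : tangent_Q c (x s) dx).
{ apply (tangent_Q_velocity c x dx s Hc); [|exact Dx].
  revert L; apply filter_imp; intros r [H _]; exact H. }
assert (Ey : y = (fun i => 1 * dx i + - th * n s i)).
{ apply functional_extensionality; intros i; rewrite Edx; ring. }
assert (Ty : tangent_Q c (x s) y) by (rewrite Ey; apply tangent_Q_combination; assumption).
assert (Eny : inner c (n s) y = 0).
{ rewrite Ey, inner_combination_r, Enx, Enn; ring. }
assert (Enn' : inner c dn (n s) = 0).
{ pose proof (is_derive_inner c n n s dn dn Dn Dn) as D; rewrite (inner_sym c (n s) dn) in D.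
  assert (E : inner c dn (n s) + inner c dn (n s) = 0); [|lra].
  apply (is_derive_locally_const _ s 1 _) with (2 := D).
  revert L; apply filter_imp; intros r [_ [_ H]]; exact H. }
split; [exact Ty | split; [exact Eny|]].
set (z := fun i => 1 * dn i + 1 * (k * y i + IZR c * th * x s i)).
enough (Z : forall i, z i = 0) by (intros i; specialize (Z i); unfold z in Z; lra).
assert (Exn := tangent_Q_inner c _ _ Tn).
assert (Exy := tangent_Q_inner c _ _ Ty).
apply (tangent_orthogonal_zero c (x s) (n s) y z); try assumption.
- assert (Dxn := is_derive_inner c x n s dx dn Dx Dn).
  destruct Hc as [E|[E|E]]; subst c; unfold z; simpl.
  + assert (E : inner (-1) dx (n s) + inner (-1) (x s) dn = 0).
    { apply (is_derive_locally_const _ s 0 _) with (2 := Dxn).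
      revert L; apply filter_imp; intros r [_ [H _]]; exact H. }
    rewrite inner_sym, Enx in E.
    rewrite !inner_combination_r; simpl in *; rewrite Ty, (proj1 Qx); lra.
  + assert (E : dn X3 = 0).
    { apply (is_derive_locally_const _ s 0 _) with (2 := Dn X3).
      revert L; apply filter_imp; intros r [_ [H _]]; exact H. }
    simpl in *; rewrite E, Ty; ring.
  + assert (E : inner 1 dx (n s) + inner 1 (x s) dn = 0).
    { apply (is_derive_locally_const _ s 0 _) with (2 := Dxn).
      revert L; apply filter_imp; intros r [_ [H _]]; exact H. }
    rewrite inner_sym, Enx in E.
    rewrite !inner_combination_r; simpl in *; rewrite Ty, Qx; lra.
- rewrite inner_sym; exact Eny.
- unfold z; rewrite !inner_combination_l, Enn', (inner_sym c y), Eny.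
  replace (IZR c * th * inner c (x s) (n s)) with (th * (IZR c * inner c (x s) (n s))) by ring.
  rewrite Exn; ring.
- unfold z; rewrite !inner_combination_l.
  replace (IZR c * th * inner c (x s) y) with (th * (IZR c * inner c (x s) y)) by ring.
  assert (Edy : inner c dn y = - k * inner c y y).
  { transitivity (inner c dn (fun i => 1 * dx i + - th * n s i)); [rewrite <- Ey; reflexivity|].
    rewrite inner_combination_r, Ek, Enn'; ring. }
  rewrite Exy, Edy; ring.
Qed.

(** Rotating the frame (x, n) by the angle t in the plane that x and n span
    undoes the rotation of speed th contained in dx and dn: only multiples of y
    remain, in both derivatives.  It is here that the curvature appears, as
    minus the quotient of the two multiples. *)
Lemma geodesic_rotation_velocity (c : Z) (x n : R -> vec) (dx dn y : vec)
    (t : R -> R) (th k s : R) :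
  (c = (-1)%Z \/ c = 0%Z \/ c = 1%Z) ->
  (forall i, is_derive (fun r => x r i) s (dx i)) ->
  (forall i, is_derive (fun r => n r i) s (dn i)) ->
  is_derive t s th ->
  (forall i, dx i = th * n s i + y i) ->
  (forall i, dn i = - k * y i - IZR c * th * x s i) ->
  forall i,
  is_derive (fun r => cos_c c (t r) * x r i + - sin_c c (t r) * n r i) s
    ((cos_c c (t s) + k * sin_c c (t s)) * y i) /\
  is_derive (fun r => IZR c * sin_c c (t r) * x r i + cos_c c (t r) * n r i) s
    ((IZR c * sin_c c (t s) - k * cos_c c (t s)) * y i).
Proof.
intros Hc Dx Dn Dt Edx Edn i.
assert (DC : is_derive (fun r => cos_c c (t r)) s (th * (- IZR c * sin_c c (t s)))).
{ exact (is_derive_comp (cos_c c) t s _ _ (is_derive_cos_c c (t s) Hc) Dt). }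
assert (DS : is_derive (fun r => sin_c c (t r)) s (th * cos_c c (t s))).
{ exact (is_derive_comp (sin_c c) t s _ _ (is_derive_sin_c c (t s) Hc) Dt). }
split.
- replace (_ * y i) with ((th * (- IZR c * sin_c c (t s)) * x s i + cos_c c (t s) * dx i)
    + (- (th * cos_c c (t s)) * n s i + - sin_c c (t s) * dn i))
    by (rewrite Edx, Edn; ring).
  apply (is_derive_plus (fun r => cos_c c (t r) * x r i) (fun r => - sin_c c (t r) * n r i)).
  + exact (is_derive_Rmult _ _ s _ _ DC (Dx i)).
  + exact (is_derive_Rmult _ _ s _ _ (is_derive_opp _ s _ DS) (Dn i)).
- replace (_ * y i) with ((IZR c * (th * cos_c c (t s)) * x s i
      + IZR c * sin_c c (t s) * dx i)
    + (th * (- IZR c * sin_c c (t s)) * n s i + cos_c c (t s) * dn i))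
    by (rewrite Edx, Edn; ring).
  apply (is_derive_plus (fun r => IZR c * sin_c c (t r) * x r i)
    (fun r => cos_c c (t r) * n r i)).
  + exact (is_derive_Rmult _ _ s _ _ (is_derive_scal _ s (IZR c) _ DS) (Dx i)).
  + exact (is_derive_Rmult _ _ s _ _ DC (Dn i)).
Qed.

Lemma geodesic_rotation_normal (c : Z) (x n y : vec) (t : R) :
  (c = (-1)%Z \/ c = 0%Z \/ c = 1%Z) ->
  in_Q c x -> tangent_Q c x n -> inner c n n = 1 ->
  tangent_Q c x y -> inner c n y = 0 ->
  let gam := fun i => cos_c c t * x i + - sin_c c t * n i in
  let nu := fun i => IZR c * sin_c c t * x i + cos_c c t * n i in
  tangent_Q c gam nu /\ inner c nu nu = 1 /\ inner c nu y = 0.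
Proof.
intros Hc Qx Tn Enn Ty Eny gam nu.
pose proof (cos_sin_c c t Hc) as CS.
pose proof (in_Q_inner c x Hc Qx) as Exx.
pose proof (tangent_Q_inner c _ _ Tn) as Exn.
pose proof (tangent_Q_inner c _ _ Ty) as Exy.
split; [|split].
- destruct Hc as [E|[E|E]]; subst c; unfold gam, nu; simpl in *.
  + rewrite inner_combination_l, !inner_combination_r, Enn, (inner_sym _ n), Tn.
    rewrite (proj1 Qx); ring.
  + rewrite Qx, Tn; ring.
  + rewrite inner_combination_l, !inner_combination_r, Enn, (inner_sym _ n), Tn.
    rewrite Qx; ring.
- unfold nu; rewrite inner_combination_l, !inner_combination_r, Enn, (inner_sym _ n).
  transitivity (sin_c c t * sin_c c t * (IZR c * (IZR c * inner c x x))
    + 2 * sin_c c t * cos_c c t * (IZR c * inner c x n)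
    + cos_c c t * cos_c c t); [ring|].
  rewrite Exx, Exn, <- CS.
  destruct Hc as [->|[->| ->]]; simpl; ring.
- unfold nu; rewrite inner_combination_l, Eny.
  replace (IZR c * sin_c c t * inner c x y) with (sin_c c t * (IZR c * inner c x y)) by ring.
  rewrite Exy; ring.
Qed.

(** Clearing cot_c merges the two branches of the formula. *)
Lemma kappa_formula_eq (c : Z) (w : R -> R) (t0 t : R) :
  (c = (-1)%Z \/ c = 0%Z \/ c = 1%Z) -> kappa_defined c w t0 t ->
  cos_c c (theta w t0 t) + Derive w t * sin_c c (theta w t0 t) <> 0 /\
  kappa_formula c w t0 t *
    (cos_c c (theta w t0 t) + Derive w t * sin_c c (theta w t0 t)) =
  Derive w t * cos_c c (theta w t0 t) - IZR c * sin_c c (theta w t0 t).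
Proof.
intros Hc; unfold kappa_defined, kappa_formula, cot_c.
pose proof (cos_sin_c c (theta w t0 t) Hc) as CS.
set (C := cos_c c (theta w t0 t)) in *; set (S := sin_c c (theta w t0 t)) in *.
intros K; destruct Req_EM_T as [E|E].
- rewrite E in *; split; [intros F; nra | ring].
- specialize (K E).
  assert (F : C + Derive w t * S <> 0).
  { intros F; apply K; apply Rmult_eq_reg_r with S; [|exact E].
    transitivity (C + Derive w t * S); [field; exact E | lra]. }
  split; [exact F | field].
  split; [exact E|].
  rewrite Rplus_comm; exact F.
Qed.

Theorem corollary2 :
  forall (c : Z) (a b : Rbar) (w : R -> R) (t0 : R) (p q : Rbar) (g : R -> pt),
    (c = (-1)%Z \/ c = 0%Z \/ c = 1%Z) ->
    smooth_on (open_interval a b) w ->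
    (forall t, open_interval a b t -> 0 < w t) ->
    open_interval a b t0 ->
    curve_in c (open_interval a b) (open_interval p q) g ->
    regular_curve (open_interval p q) g ->
    spacelike c w (open_interval p q) g ->
    null_acceleration c w (open_interval p q) g ->
    fixed_null_direction c w (open_interval p q) g ->
    exists (gam nu : R -> vec) (tau kappa : R -> R),
      C_on (open_interval p q) 2 tau /\
      (forall s, open_interval p q s -> open_interval a b (tau s)) /\
      (forall i, C_on (open_interval p q) 1 (fun s => gam s i)) /\
      (forall s, open_interval p q s -> in_Q c (gam s)) /\
      unit_normal c (open_interval p q) gam nu /\
      (forall s, open_interval p q s ->
        (forall i, g s (Some i) =
           cos_c c (theta w t0 (tau s)) * gam s i + sin_c c (theta w t0 (tau s)) * nu s i)
        /\ g s None = tau s) /\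
      (forall s, open_interval p q s -> kappa_defined c w t0 (tau s) ->
        (exists i, vvelocity gam s i <> 0) /\
        (forall i, vvelocity nu s i = - kappa s * vvelocity gam s i) /\
        kappa s = kappa_formula c w t0 (tau s)).
Proof.
intros c a b w t0 p q g Hc Hw Pw Ht0 [Hg HQ] _ Hsp _ [N HN].
set (tau := fun s => g s None).
set (x := fun s => space (g s)).
set (v := fun s => space (velocity g s)).
(* the null normal field rescaled to (n / w, 1) *)
set (n := fun s i => w (tau s) / N s None * N s (Some i)).
set (th := fun s => theta w t0 (tau s)).
(* the derivative of th, and the component of the velocity along n *)
set (h := fun s => velocity g s None / w (tau s)).
assert (W1 : forall t, open_interval a b t -> C1_at w t).
{ intros t; exact (C1_at_of_C_on a b w t (Hw 1%nat)). }
assert (Pt : forall s, open_interval p q s -> 0 < w (tau s)).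
{ intros s Hs; exact (Pw _ (proj2 (HQ s Hs))). }
assert (G1 : forall s, open_interval p q s -> forall k, C1_at (fun r => g r k) s).
{ intros s Hs k; exact (C1_at_of_C_on_2 p q _ s (Hg k) Hs). }
assert (G2 : forall s, open_interval p q s -> forall k, C1_at (fun r => velocity g r k) s).
{ intros s Hs k; exact (C1_at_Derive_of_C_on_2 p q _ s (Hg k) Hs). }
assert (W2 : forall s, open_interval p q s -> C1_at (fun r => w (tau r)) s).
{ intros s Hs; exact (C1_at_comp w tau s (W1 _ (proj2 (HQ s Hs))) (G1 s Hs None)). }
assert (Dx : forall s, open_interval p q s -> forall i, is_derive (fun r => x r i) s (v s i)).
{ intros s Hs i; apply Derive_correct, C1_at_ex; exact (G1 s Hs (Some i)). }
assert (Tv : forall s, open_interval p q s -> tangent_Q c (x s) (v s)).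
{ intros s Hs; apply (tangent_Q_velocity c x (v s) s Hc); [|exact (Dx s Hs)].
  generalize (open_interval_open p q s Hs); apply filter_imp; intros r Hr.
  exact (proj1 (HQ r Hr)). }
assert (N0 : forall s, open_interval p q s -> N s None <> 0).
{ intros s Hs; destruct (HN s Hs) as [_ [Nz [TN [ENN _]]]].
  apply (null_normal_time c w (g s) (N s)); auto.
  - exact (proj1 (HQ s Hs)).
  - apply Rgt_not_eq; exact (Pt s Hs). }
assert (Fn : forall s, open_interval p q s ->
  in_Q c (x s) /\ tangent_Q c (x s) (v s) /\ tangent_Q c (x s) (n s) /\
  inner c (n s) (n s) = 1 /\ inner c (n s) (v s) = h s).
{ intros s Hs; destruct (HN s Hs) as [_ [_ [TN [ENN [ENv _]]]]].
  split; [exact (proj1 (HQ s Hs)) | split; [exact (Tv s Hs) | split]].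
  - exact (tangent_Q_scal c _ _ (w (tau s) / N s None) TN).
  - apply (null_direction_unit c w (g s) (velocity g s) (N s)); auto.
    apply Rgt_not_eq; exact (Pt s Hs). }
assert (Lt : forall s, open_interval p q s -> h s * h s < inner c (v s) (v s)).
{ intros s Hs; pose proof (Hsp s Hs) as P; rewrite dotw_eq in P; pose proof (Pt s Hs) as Q.
  apply Rmult_lt_reg_l with (w (tau s) ^ 2); [apply pow_lt; exact Q|].
  replace (w (tau s) ^ 2 * (h s * h s)) with (velocity g s None * velocity g s None)
    by (unfold h; field; lra).
  unfold v, tau; lra. }
assert (H1 : forall s, open_interval p q s -> C1_at h s).
{ intros s Hs; apply C1_at_div; [exact (G2 s Hs None) | exact (W2 s Hs) |].
  apply Rgt_not_eq; exact (Pt s Hs). }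
assert (n1 : forall s, open_interval p q s -> forall i, C1_at (fun r => n r i) s).
{ intros s Hs; destruct (HN s Hs) as [CN _].
  apply (C1_at_unit_field c x v n h s).
  - generalize (open_interval_open p q s Hs); apply filter_imp; exact Fn.
  - intros i; exact (G1 s Hs (Some i)).
  - intros i; exact (G2 s Hs (Some i)).
  - exact (H1 s Hs).
  - intros i; unfold n.
    apply (continuous_mult (fun r => w (tau r) / N r None)); [|apply CN].
    apply (continuous_mult (fun r => w (tau r)) (fun r => / N r None)).
    + exact (C1_at_continuous _ s (W2 s Hs)).
    + apply (continuous_comp (fun r => N r None) Rinv s (CN None)).
      apply C1_at_continuous, C1_at_Rinv, N0, Hs.
  - exact (Lt s Hs). }
(* the component of the velocity orthogonal to n, nonzero as the curve is
   spacelike *)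
set (y := fun s i => v s i - h s * n s i).
assert (Eyy : forall s, open_interval p q s ->
  inner c (y s) (y s) = inner c (v s) (v s) - h s * h s).
{ intros s Hs; destruct (Fn s Hs) as [_ [_ [_ [Enn Env]]]].
  transitivity (inner c (v s) (v s) - 2 * h s * inner c (n s) (v s)
    + h s * h s * inner c (n s) (n s)); [unfold y, inner; ring | rewrite Enn, Env; ring]. }
assert (Ek : forall s, open_interval p q s ->
  inner c (vvelocity n s) (v s) = - Derive w (tau s) * inner c (y s) (y s)).
{ intros s Hs; destruct (HN s Hs) as [_ [_ [TN [ENN [ENv [f Hf]]]]]].
  assert (Qn : w (tau s) <> 0) by (apply Rgt_not_eq; exact (Pt s Hs)).
  pose proof (W1 _ (proj2 (HQ s Hs))) as Hws.
  pose proof (null_acceleration_equation c w g s (N s) f Hws Qn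
    (G1 s Hs) (G2 s Hs) (Hsp s Hs) TN ENN ENv Hf) as E.
  rewrite (Eyy s Hs), <- (proj2 (proj2 (proj2 (proj2 (Fn s Hs))))).
  apply (null_acceleration_rotation c w g n s (N s)); auto.
  generalize (open_interval_open p q s Hs); apply filter_imp; intros r Hr.
  change (velocity g r None = inner c (n r) (v r) * w (tau r)).
  rewrite (proj2 (proj2 (proj2 (proj2 (Fn r Hr))))); unfold h; field.
  apply Rgt_not_eq; exact (Pt r Hr). }
assert (Dth : forall s, open_interval p q s -> is_derive th s (h s)).
{ intros s Hs; apply (is_derive_comp (theta w t0) tau s (/ w (tau s))).
  - apply (is_derive_theta a b); auto; [|exact (proj2 (HQ s Hs))].
    intros r Hr; apply C1_at_continuous, W1, Hr.
  - apply Derive_correct, C1_at_ex; exact (G1 s Hs None). }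
assert (th1 : forall s, open_interval p q s -> C1_at th s).
{ intros s Hs; exists h; split.
  - generalize (open_interval_open p q s Hs); apply filter_imp; exact Dth.
  - apply C1_at_continuous, H1, Hs. }
assert (Fy : forall s, open_interval p q s ->
  tangent_Q c (x s) (y s) /\ inner c (n s) (y s) = 0 /\
  (forall i, vvelocity n s i = - Derive w (tau s) * y s i - IZR c * h s * x s i)).
{ intros s Hs.
  apply (unit_field_velocity c x n (v s) (vvelocity n s) (y s) (h s) (Derive w (tau s)) s Hc).
  - generalize (open_interval_open p q s Hs); apply filter_imp; intros r Hr.
    destruct (Fn r Hr) as [? [? [? [? ?]]]]; auto.
  - exact (Dx s Hs).
  - intros i; apply Derive_correct, C1_at_ex, n1, Hs.
  - exact (proj2 (proj2 (proj2 (proj2 (Fn s Hs))))).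
  - intros i; unfold y; ring.
  - rewrite (Eyy s Hs); pose proof (Lt s Hs); lra.
  - exact (Ek s Hs). }
(* gam and nu are the position and velocity at time - th of the geodesic with
   position x and velocity n at time 0 *)
set (gam := fun s i => cos_c c (th s) * x s i + - sin_c c (th s) * n s i).
set (nu := fun s i => IZR c * sin_c c (th s) * x s i + cos_c c (th s) * n s i).
assert (V : forall s, open_interval p q s -> forall i,
  vvelocity gam s i = (cos_c c (th s) + Derive w (tau s) * sin_c c (th s)) * y s i /\
  vvelocity nu s i = (IZR c * sin_c c (th s) - Derive w (tau s) * cos_c c (th s)) * y s i).
{ intros s Hs i.
  destruct (geodesic_rotation_velocity c x n (v s) (vvelocity n s) (y s) th (h s)
    (Derive w (tau s)) s Hc (Dx s Hs)) with (i := i) as [A B].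
  - intros j; apply Derive_correct, C1_at_ex, n1, Hs.
  - exact (Dth s Hs).
  - intros j; unfold y; ring.
  - exact (proj2 (proj2 (Fy s Hs))).
  - split; apply is_derive_unique; assumption. }
assert (Cth : forall s, open_interval p q s -> C1_at (fun r => cos_c c (th r)) s).
{ intros s Hs; apply (C1_at_comp (cos_c c) th s); [apply C1_at_cos_c, Hc | exact (th1 s Hs)]. }
assert (Sth : forall s, open_interval p q s -> C1_at (fun r => sin_c c (th r)) s).
{ intros s Hs; apply (C1_at_comp (sin_c c) th s); [apply C1_at_sin_c, Hc | exact (th1 s Hs)]. }
exists gam, nu, tau, (fun s => kappa_formula c w t0 (tau s)).
split; [exact (Hg None)|].
split; [intros s Hs; exact (proj2 (HQ s Hs))|].
split.
{ intros i; apply C_on_of_C1_at; intros s Hs.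
  exact (C1_at_plus _ _ s (C1_at_mult _ _ s (Cth s Hs) (G1 s Hs (Some i)))
    (C1_at_mult _ _ s (C1_at_opp _ s (Sth s Hs)) (n1 s Hs i))). }
split.
{ intros s Hs; destruct (Fn s Hs) as [Qx [_ [Tn [Enn _]]]].
  exact (in_Q_geodesic c (x s) (n s) (th s) Hc Qx Tn Enn). }
split.
{ split.
  - intros i; apply C_on_of_C1_at; intros s Hs.
    exact (C1_at_plus _ _ s
      (C1_at_mult _ _ s (C1_at_mult _ _ s (C1_at_const (IZR c) s) (Sth s Hs)) (G1 s Hs (Some i)))
      (C1_at_mult _ _ s (Cth s Hs) (n1 s Hs i))).
  - intros s Hs; destruct (Fn s Hs) as [Qx [_ [Tn [Enn _]]]].
    destruct (Fy s Hs) as [Ty [Eny _]].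
    destruct (geodesic_rotation_normal c (x s) (n s) (y s) (th s) Hc Qx Tn Enn Ty Eny)
      as [Tnu [Enu Enuy]].
    split; [exact Tnu | split; [exact Enu|]].
    transitivity ((cos_c c (th s) + Derive w (tau s) * sin_c c (th s))
      * inner c (nu s) (y s)).
    + unfold inner; rewrite !(fun i => proj1 (V s Hs i)); ring.
    + change (inner c (nu s) (y s) = 0) in Enuy; rewrite Enuy; ring. }
split.
{ intros s Hs; split; [|reflexivity].
  intros i; fold (th s); pose proof (cos_sin_c c (th s) Hc) as CS.
  unfold gam, nu; transitivity ((cos_c c (th s) * cos_c c (th s)
    + IZR c * (sin_c c (th s) * sin_c c (th s))) * x s i); [|ring].
  rewrite CS; unfold x, space; ring. }
intros s Hs K; destruct (kappa_formula_eq c w t0 (tau s) Hc K) as [F E].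
fold (th s) in F, E.
split; [|split; [|reflexivity]].
- apply not_all_not_ex; intros Z.
  assert (Zy : forall i, y s i = 0).
  { intros i; apply Rmult_eq_reg_l with
      (cos_c c (th s) + Derive w (tau s) * sin_c c (th s)); [|exact F].
    rewrite <- (proj1 (V s Hs i)), Rmult_0_r.
    destruct (Req_dec (vvelocity gam s i) 0) as [H|H]; [exact H | destruct (Z i H)]. }
  pose proof (Lt s Hs); pose proof (Eyy s Hs) as Y.
  unfold inner at 1 in Y; rewrite !Zy in Y; lra.
- intros i; rewrite (proj1 (V s Hs i)), (proj2 (V s Hs i)).
  transitivity (- (kappa_formula c w t0 (tau s) *
    (cos_c c (th s) + Derive w (tau s) * sin_c c (th s))) * y s i); [rewrite E|]; ring.
Qed.
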